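(* Let $L:[0,1]\to[0,1]$ be the piecewise linear (PL) map associated with a sequence $(\epsilon_k)_{k\ge0}$, and let $Z=\{I_0,I_1\}$ with $I_0=[0,\epsilon_0]$, $I_1=(\epsilon_0,1]$. Let $F(x)=\sum_{k=1}^{\lfloor x\rfloor}(\epsilon_{k-2}-\epsilon_{k-1})$ for $x\ge1$, and suppose that $1-F(x)\sim A x^{-\alpha}$ as $x\to\infty$ for some constants $A>0$ and $\alpha>0$, $\alpha\ne1$. Let $m$ be Lebesgue measure on $[0,1]$ and $N_n(x)=\#\{0\le i\le n-1: L^i(x)\in I_1\}$. Then $$\mathbb E_m[N_n]\ \preceq\ \mathbb E_m[AIC(x,n,Z)]\ \preceq\ \mathbb E_m[N_n]\,\log n .$$
   Context: **PL map.** Let $(\epsilon_k)_{k\ge0}$ be a strictly decreasing sequence of positive real numbers converging to $0$, put $\epsilon_{-1}=1$ (with $\epsilon_0<1$), and assume $\frac{\epsilon_{k-1}-\epsilon_k}{\epsilon_{k-2}-\epsilon_{k-1}}<1$ for all $k\ge1$. The associated PL map $L:[0,1]\to[0,1]$ is $$L(x)=\begin{cases}\frac{\epsilon_{k-2}-\epsilon_{k-1}}{\epsilon_{k-1}-\epsilon_k}(x-\epsilon_k)+\epsilon_{k-1}, & \epsilon_k<x\le\epsilon_{k-1},\ k\ge1,\\[2pt] \frac{x-\epsilon_0}{1-\epsilon_0}, & \epsilon_0<x\le1,\\[2pt] 0,& x=0.\end{cases}$$ **Algorithmic information content.** For a finite alphabet $\mathcal A$, let $\mathcal A^*$ be the set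 of finite strings over $\mathcal A$. Fix a universal partial recursive function $C$ from binary strings to strings over $\mathcal A$ (universal: for every other partial recursive $D$ there is a binary string $p_{CD}$ with $D(p)=C(p_{CD}\,p)$ for all $p$). For $s\in\mathcal A^*$ put $AIC(s)=\min\{|p| : C(p)=s\}$, where $|p|$ is the binary length of $p$; up to an additive constant this does not depend on $C$. **Symbolic orbits.** For $x\in[0,1]$ let $\omega=\varphi_Z(x)\in\{0,1\}^{\mathbb N}$ be defined by $L^i(x)\in I_{\omega_i}$ for all $i\ge0$, and let $AIC(x,n,Z)=AIC(\omega_0\cdots\omega_{n-1})$. **Notation.** $\mathbb E_m$ is the expectation with respect to $m$. $a_n\preceq b_n$ means $a_n=O(b_n)$ as $n\to\infty$; $f\sim g$ means $f/g\to1$. *)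

(* Defs.v *)
From HB Require Import structures.
From mathcomp Require Import all_boot all_order all_algebra.
From mathcomp Require Import all_classical all_reals all_analysis.

Set Implicit Arguments.
Unset Strict Implicit.
Unset Printing Implicit Defensive.
Import Order.TTheory GRing.Theory Num.Theory.
Import numFieldNormedType.Exports.
Local Open Scope classical_set_scope.
Local Open Scope ring_scope.

(* [recfun n] : Kleene's mu-recursive schemes for partial functions N^n -> N. *)
Inductive recfun : nat -> Type :=
| RZero n : recfun n
| RSucc : recfun 1
| RProj n (i : 'I_n) : recfun n
| RComp m n (f : recfun m) (g : 'I_m -> recfun n) : recfun n
| RPrim n (f : recfun n) (g : recfun n.+2) : recfun n.+1
| RMu n (f : recfun n.+1) : recfun n.

(* [rec_eval f v y] : f is defined at v, with value y. In the case of
   primitive recursion, r i is the value at (i, behead v). *)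
Fixpoint rec_eval n (f : recfun n) : n.-tuple nat -> nat -> Prop :=
  match f in recfun n return n.-tuple nat -> nat -> Prop with
  | RZero _ => fun _ y => y = 0%N
  | RSucc => fun v y => y = (thead v).+1
  | RProj _ i => fun v y => y = tnth v i
  | RComp m _ f g => fun v y =>
      exists2 w : m.-tuple nat,
        forall i, rec_eval (g i) v (tnth w i) & rec_eval f w y
  | RPrim _ f g => fun v y =>
      exists r : nat -> nat,
        [/\ rec_eval f [tuple of behead v] (r 0%N),
            forall i, (i < thead v)%N ->
              rec_eval g [tuple of i :: r i :: behead v] (r i.+1)
          & y = r (thead v)]
  | RMu _ f => fun v y =>
      rec_eval f [tuple of y :: v] 0%N /\
      forall i, (i < y)%N -> exists z, rec_eval f [tuple of i :: v] z.+1
  end.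

(* Bijective base-2 numeration, a bijection from binary strings to N. *)
Fixpoint str_code (s : seq bool) : nat :=
  if s is b :: s' then (b + (str_code s').*2).+1 else 0%N.

(* Partial functions on strings are arbitrary maps into an option type,
   [None] standing for "undefined". *)
Definition partial_recursive (D : seq bool -> option (seq bool)) : Prop :=
  exists f : recfun 1, forall p s,
    D p = Some s <-> rec_eval f [tuple str_code p] (str_code s).

Definition universal (C : seq bool -> option (seq bool)) : Prop :=
  partial_recursive C /\
  forall D, partial_recursive D ->
    exists pCD : seq bool, forall p, D p = C (pCD ++ p).

(* The minimum of { |p| : C p = s }; this set is nonempty when C is universal,
   so that the default value 0 is then never used. *)
Definition AIC (C : seq bool -> option (seq bool)) (s : seq bool) : nat :=
  xget 0%N [set l : nat | (exists2 p, C p = Some s & size p = l) /\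
                          (forall p, C p = Some s -> (l <= size p)%N)].

Section PLMap.
Variable R : realType.
Implicit Types (eps : nat -> R) (x : R).

(* [epsm1 eps k] is epsilon_(k-1), with epsilon_(-1) = 1. *)
Definition epsm1 eps (k : nat) : R := if k is j.+1 then eps j else 1.

Definition PL_sequence eps : Prop :=
  [/\ forall k, 0 < eps k,
      forall k, eps k.+1 < eps k,
      eps k @[k --> \oo] --> (0 : R),
      eps 0%N < 1
    & forall k, (1 <= k)%N ->
        (epsm1 eps k - eps k) / (epsm1 eps k.-1 - epsm1 eps k) < 1].

(* For 0 < x <= epsilon_0 the index k selected here is the only k >= 1 with
   epsilon_k < x <= epsilon_(k-1). Only the values on [0, 1] matter. *)
Definition PL_map eps x : R :=
  if x == 0 then 0
  else if eps 0%N < x then (x - eps 0%N) / (1 - eps 0%N)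
  else let k := xget 1%N [set k | (1 <= k)%N /\ eps k < x <= epsm1 eps k] in
       (epsm1 eps k.-1 - epsm1 eps k) / (epsm1 eps k - eps k) * (x - eps k)
       + epsm1 eps k.

(* The partition Z : [PL_cell eps false] is I_0, [PL_cell eps true] is I_1. *)
Definition PL_cell eps (b : bool) : set R :=
  if b then [set` `]eps 0%N, 1]] else [set` `[0, eps 0%N]].

(* The symbol omega_i of x; since L maps [0, 1] into itself and I_0, I_1
   partition [0, 1], it is the b such that L^i(x) lies in I_b. *)
Definition PL_symbol eps x (i : nat) : bool :=
  iter i (PL_map eps) x \in PL_cell eps true.

Definition AIC_orbit (C : seq bool -> option (seq bool)) eps (n : nat) x : nat :=
  AIC C (mkseq (PL_symbol eps x) n).

Definition visits eps (n : nat) x : nat :=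
  #|[pred i : 'I_n | iter i (PL_map eps) x \in PL_cell eps true]|.

(* Num.truncn is the floor, as a natural number, of a nonnegative real. *)
Definition PL_F eps x : R :=
  \sum_(1 <= k < (Num.truncn x).+1) (epsm1 eps k.-1 - epsm1 eps k).

Definition expectation01 (X : R -> nat) : \bar R :=
  (\int[lebesgue_measure]_(x in `[0%R, 1%R]) (X x)%:R%:E)%E.

(* a_n = O(b_n) as n tends to infinity, for extended real sequences. *)
Definition preceq (a b : nat -> \bar R) : Prop :=
  exists c : R, \forall n \near \oo, (`|a n| <= c%:E * `|b n|)%E.

End PLMap.

(* Main.v *)
Require Import Defs.
From HB Require Import structures.
From mathcomp Require Import all_boot all_order all_algebra.
From mathcomp Require Import all_classical all_reals all_analysis.
From mathcomp Require Import measurable_realfun.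
From mathcomp Require Import zify ring lra.

Set Implicit Arguments.
Unset Strict Implicit.
Unset Printing Implicit Defensive.
Import Order.TTheory GRing.Theory Num.Theory.
Import numFieldNormedType.Exports.
Local Open Scope classical_set_scope.
Local Open Scope ring_scope.

(** The map L is affine from each (eps_k, eps_(k-1)] onto the next interval to
the right, and from (eps_0, 1] onto (0, 1]. Hence each (eps_k, eps_(k-1)] is
mapped affinely onto (0, 1] by the iterate that follows the first visit to I_1,
and under Lebesgue measure the symbolic orbit is a renewal process: the word
0^k 1 s has probability (eps_(k-1) - eps_k) times that of s. With
q = max (eps_0, 1 - eps_0) < 1 this gives a bound P(s) <= q^N(s), where N(s) is
the number of ones of s ([cylinder_itv]), and expectations of functions of the
first n symbols become finite sums over words ([itinerary_law]).

Upper bound. A word of length n with N ones is determined by the N + 1 numbers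
consisting of the positions of its ones and of n. Writing these in binary with
separators costs O((N + 1) log n) bits, and a mu-recursive machine recovers the
word, so that AIC(s) <= c (N(s) + 1) log n ([AIC_le_count]). The + 1 is absorbed
because E[N_n] >= 1 - q ([mean_ge_of_inj0]: N vanishes on one word only, and
every nonempty word has probability at most q).

Lower bound. It is a form of the inequality between entropy and mean code
length. Choose D with q^D <= 1/4. Since P(s) <= q^N(s), the excess
P(s) (N(s) - D AIC(s)) is at most q^(D AIC(s)) / (1 - q)
([mean_le_of_length]). There are at most 2^l words of complexity l, so the sum
of q^(D AIC(s)) over all words is at most the sum of 2^l / 4^l, which is 2
([sum_AIC_le]). Hence E[N_n] <= D E[AIC] + 2 / (1 - q), and the constant is
absorbed because E[AIC] >= 1 - q: the empty program outputs one word at most. *)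

(** * Total mu-recursive functions *)

Definition computable n (F : n.-tuple nat -> nat) : Prop :=
  exists f : recfun n, forall v y, rec_eval f v y <-> y = F v.

Lemma computable_proj n (i : 'I_n) : computable (fun v => tnth v i).
Proof. by exists (RProj i). Qed.

Lemma computable_zero n : computable (fun _ : n.-tuple nat => 0%N).
Proof. by exists (RZero n). Qed.

Lemma computable_comp m n (F : m.-tuple nat -> nat)
    (G : 'I_m -> n.-tuple nat -> nat) :
  computable F -> (forall i, computable (G i)) ->
  computable (fun v => F [tuple G i v | i < m]).
Proof.
move=> [f fP] /choice[g gP]; exists (RComp f g) => v y /=.
split=> [[w gw /fP ->]|->].
  congr F; apply: eq_from_tnth => i; rewrite tnth_mktuple.
  exact/gP/gw.
exists [tuple G i v | i < m]; last exact/fP.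
by move=> i; apply/gP; rewrite tnth_mktuple.
Qed.

Lemma computable_succ n (G : n.-tuple nat -> nat) :
  computable G -> computable (fun v => (G v).+1).
Proof.
move=> cG; have cS : computable (fun v : 1.-tuple nat => (thead v).+1).
  by exists RSucc.
have := computable_comp cS (fun=> cG); congr computable.
by apply: funext => v; rewrite /thead tnth_mktuple.
Qed.

(** The sequence r required by [rec_eval] on a primitive recursion is forced
below the recursion argument, where it agrees with [nat_rec]. *)
Lemma computable_prim n (F : n.-tuple nat -> nat) (G : n.+2.-tuple nat -> nat) :
  computable F -> computable G ->
  computable (fun v : n.+1.-tuple nat =>
    nat_rec (fun=> nat) (F [tuple of behead v])
      (fun i r => G [tuple of i :: r :: behead v]) (thead v)).
Proof.
move=> [f fP] [g gP]; exists (RPrim f g) => v y /=.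
split=> [[r [/fP r0 rS ->]]|->].
  have rE i : (i <= thead v)%N -> r i = nat_rec (fun=> nat)
      (F [tuple of behead v]) (fun i r => G [tuple of i :: r :: behead v]) i.
    elim: i => [//|i IH] lt_iv /=.
    by rewrite -IH ?(ltnW lt_iv)//; apply/gP/rS.
  exact: rE.
eexists; split; [|move=> i _|reflexivity]; first exact/fP.
exact/gP.
Qed.

(** Recursion in the form used below: the number of steps and the initial value
are arbitrary computable functions of the parameters. It is obtained by
composing the primitive recursion on n.+1 arguments with (M v, v). *)
Lemma computable_rec n (A M : n.-tuple nat -> nat)
    (S : nat -> nat -> n.-tuple nat -> nat) :
  computable A ->
  computable (fun w : n.+2.-tuple nat =>
    S (thead w) (thead [tuple of behead w])
      [tuple of behead [tuple of behead w]]) ->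
  computable M ->
  computable (fun v => nat_rec (fun=> nat) (A v) (fun i r => S i r v) (M v)).
Proof.
move=> cA cS cM; have cR := computable_prim cA cS.
pose G (i : 'I_n.+1) (v : n.-tuple nat) :=
  if unlift ord0 i is Some j then tnth v j else M v.
have cG i : computable (G i).
  by rewrite /G; case: (unlift _ i) => [j|//]; exact: computable_proj.
have := computable_comp cR cG; congr computable; apply: funext => v.
set w := mktuple _.
have w0 : thead w = M v by rewrite /thead tnth_mktuple /G unlift_none.
have wb : [tuple of behead w] = v.
  apply: eq_from_tnth => j; rewrite tnth_behead tnth_mktuple /G.
  suff -> : inord j.+1 = lift ord0 j by rewrite liftK.
  by apply: val_inj; rewrite /= inordK //= ltnS ltn_ord.
rewrite w0 wb; elim: (M v) => [//|k /= ->].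
by rewrite -[X in _ = S _ _ X]wb; congr (S _ _ _); apply: val_inj.
Qed.

Lemma computable_rec_index n : computable (fun w : n.+2.-tuple nat => thead w).
Proof. exact: computable_proj. Qed.

Lemma computable_rec_value n :
  computable (fun w : n.+2.-tuple nat => thead [tuple of behead w]).
Proof.
have := computable_proj (lift ord0 (ord0 : 'I_n.+1)); congr computable.
apply: funext => w; rewrite /thead tnth_behead; congr tnth.
by apply: val_inj; rewrite /= inordK.
Qed.

Lemma computable_rec_param n (G : n.-tuple nat -> nat) :
  computable G ->
  computable (fun w : n.+2.-tuple nat =>
    G [tuple of behead [tuple of behead w]]).
Proof.
move=> cG.
have := computable_comp cG
  (fun i => computable_proj (lift ord0 (lift ord0 i))).
congr computable; apply: funext => w; congr G; apply: eq_from_tnth => i.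
rewrite tnth_mktuple !tnth_behead; congr tnth; apply: val_inj => /=.
by rewrite !inordK // !ltnS ?ltn_ord // ltnW // ltnS ltn_ord.
Qed.

Lemma computable_pred n (G : n.-tuple nat -> nat) :
  computable G -> computable (fun v => (G v).-1).
Proof.
move=> cG; have := computable_rec (S := fun i _ _ => i)
  (@computable_zero n) (@computable_rec_index n) cG.
by congr computable; apply: funext => v; case: (G v).
Qed.

Lemma computable_sub n (G H : n.-tuple nat -> nat) :
  computable G -> computable H -> computable (fun v => (G v - H v)%N).
Proof.
move=> cG cH; have := computable_rec (S := fun _ r _ => r.-1)
  cG (computable_pred (@computable_rec_value n)) cH.
congr computable; apply: funext => v.
by elim: (H v) => [|k /= ->]; rewrite ?subn0 ?subnS.
Qed.

Lemma computable_add n (G H : n.-tuple nat -> nat) :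
  computable G -> computable H -> computable (fun v => (G v + H v)%N).
Proof.
move=> cG cH; have := computable_rec (S := fun _ r _ => r.+1)
  cG (computable_succ (@computable_rec_value n)) cH.
congr computable; apply: funext => v.
by elim: (H v) => [|k /= ->]; rewrite ?addn0 ?addnS.
Qed.

(** Uses the recursion half (k + 1) = k - half k, which avoids division. *)
Lemma computable_half n (G : n.-tuple nat -> nat) :
  computable G -> computable (fun v => (G v)./2).
Proof.
move=> cG; have := computable_rec (S := fun i r _ => (i - r)%N)
  (@computable_zero n) (computable_sub (@computable_rec_index n)
    (@computable_rec_value n)) cG.
congr computable; apply: funext => v.
by elim: (G v) => [//|k /= ->]; rewrite uphalfE; lia.
Qed.

Lemma computable_odd n (G : n.-tuple nat -> nat) :
  computable G -> computable (fun v => odd (G v) : nat).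
Proof.
move=> cG; have := computable_rec (S := fun _ r _ => (1 - r)%N)
  (@computable_zero n) (computable_sub
     (computable_succ (@computable_zero _)) (@computable_rec_value n)) cG.
congr computable; apply: funext => v.
by elim: (G v) => [//|k /= ->]; case: odd.
Qed.

Lemma computable_exp2 n (G : n.-tuple nat -> nat) :
  computable G -> computable (fun v => 2 ^ G v)%N.
Proof.
move=> cG; have := computable_rec (S := fun _ r _ => (r + r)%N)
  (computable_succ (@computable_zero n))
  (computable_add (@computable_rec_value n) (@computable_rec_value n)) cG.
congr computable; apply: funext => v.
by elim: (G v) => [//|k /= ->]; rewrite addnn -mul2n expnS.
Qed.

(** A conditional is a recursion with zero or one step. *)
Lemma computable_if n (B : n.-tuple nat -> bool) (G H : n.-tuple nat -> nat) :
  computable (fun v => B v : nat) -> computable G -> computable H ->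
  computable (fun v => if B v then G v else H v).
Proof.
move=> cB cG cH; have := computable_rec (S := fun _ _ v => G v)
  cH (computable_rec_param cG) cB.
by congr computable; apply: funext => v; case: (B v).
Qed.

(** * A machine that writes a list of positions *)

(** The decoder reads its program two letters at a time, and holds one number.
On (true, b) it appends the bit ~~ b to the number; on a pair starting with
false it adds 2 to the power of the number to its output, and resets the
number (in bijective base 2). Everything is expressed on [str_code], where
dropping the first letter is c |-> c.-1./2, where the first letter is false
exactly when c is odd, and where the empty string has code 0. Since 0 is even,
the output stays unchanged once the program has been read, so running the
machine for c steps is safe. *)
Definition code_drop2 (c : nat) : nat := c.-1./2.-1./2.

Definition tape (c i : nat) : nat :=
  nat_rec (fun=> nat) c (fun _ r => code_drop2 r) i.

Definition register (c i : nat) : nat :=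
  nat_rec (fun=> nat) 0%N (fun i r =>
    if odd (tape c i) then 0%N
    else (r + r + odd (tape c i).-1./2).+1)%N i.

Definition output (c i : nat) : nat :=
  nat_rec (fun=> nat) 0%N (fun i r =>
    if odd (tape c i) then (r + 2 ^ register c i)%N else r) i.

(** The number c itself bounds the number of steps ([size_le_str_code]). The
machine writes str_code s + 1, whose binary digits are the letters of s and a
leading 1 ([sum_ones_and_end]), whence the predecessor. *)
Definition decode_positions (c : nat) : nat := (output c c).-1.

Lemma computable_tape n (G H : n.-tuple nat -> nat) :
  computable G -> computable H -> computable (fun v => tape (G v) (H v)).
Proof.
move=> cG cH; apply: (computable_rec (S := fun _ r _ => code_drop2 r)) => //.
do 2 (apply: computable_half; apply: computable_pred).
exact: computable_rec_value.
Qed.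

Lemma computable_register n (G H : n.-tuple nat -> nat) :
  computable G -> computable H -> computable (fun v => register (G v) (H v)).
Proof.
move=> cG cH; apply: (computable_rec (S := fun i r v =>
  if odd (tape (G v) i) then 0%N
  else (r + r + odd (tape (G v) i).-1./2).+1%N)) => //.
  exact: computable_zero.
have cT := computable_tape (computable_rec_param cG) (@computable_rec_index n).
have cr := @computable_rec_value n.
apply: (computable_if (computable_odd cT) (@computable_zero _)).
apply/computable_succ/computable_add; first exact: computable_add.
exact/computable_odd/computable_half/computable_pred.
Qed.

Lemma computable_output n (G H : n.-tuple nat -> nat) :
  computable G -> computable H -> computable (fun v => output (G v) (H v)).
Proof.
move=> cG cH; apply: (computable_rec (S := fun i r v =>
  if odd (tape (G v) i) then (r + 2 ^ register (G v) i)%N else r)) => //.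
  exact: computable_zero.
have cT := computable_tape (computable_rec_param cG) (@computable_rec_index n).
have cr := @computable_rec_value n.
apply: (computable_if (computable_odd cT)) => //.
apply: (computable_add cr); apply: computable_exp2.
exact: computable_register (computable_rec_param cG) (@computable_rec_index n).
Qed.

Lemma computable_decode_positions :
  computable (fun v : 1.-tuple nat => decode_positions (thead v)).
Proof.
have c0 : computable (fun v : 1.-tuple nat => thead v).
  exact: computable_proj.
exact/computable_pred/computable_output.
Qed.

Lemma str_code_inj : injective str_code.
Proof.
elim=> [|a s IH] [|b t] //= [e].
have eb : a = b by move: e; case: (a) (b) => -[]; lia.
by subst b; congr cons; apply: IH; lia.
Qed.

Lemma str_code_surj k : exists s, str_code s = k.
Proof.
elim/ltn_ind: k => -[_|k IH]; first by exists [::].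
have [|s sk] := IH k./2; first by lia.
by exists (odd k :: s); rewrite /= sk odd_double_half.
Qed.

Lemma size_le_str_code s : (size s <= str_code s)%N.
Proof. by elim: s => [//|b s IH] /=; lia. Qed.

Lemma code_drop2_cons a b s : code_drop2 (str_code [:: a, b & s]) = str_code s.
Proof. by rewrite /code_drop2 /=; case: a b => -[]; lia. Qed.

(** Bijective base-2 numeration, most significant digit first. *)
Definition load (r : nat) (w : seq bool) : nat :=
  foldl (fun r (b : bool) => (r + r + b).+1)%N r w.

(** The bits are complemented because the machine reads a letter as the parity
of a code, and an odd code starts with false. *)
Definition load_emit (w : seq bool) : seq bool :=
  flatten [seq [:: true; ~~ b] | b <- w] ++ [:: false; false].

Lemma size_load_emit w : size (load_emit w) = (size w).+1.*2.
Proof.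
rewrite size_cat addnC /=; elim: w => [//|b w IH] /=; lia.
Qed.

Lemma exec_load_emit w s c i r :
  tape c i = str_code (load_emit w ++ s) -> register c i = r ->
  let j := (i + (size w).+1)%N in
  [/\ tape c j = str_code s, register c j = 0%N
    & output c j = (output c i + 2 ^ load r w)%N].
Proof.
elim: w i r => [|b w IH] i r tE rE /=.
  rewrite addn1; split.
  - by change (code_drop2 (tape c i) = str_code s); rewrite tE code_drop2_cons.
  - rewrite /register -/(register c i) /= -/(register c i) tE /=.
    by rewrite odd_double.
  - rewrite /output /= -/(output c i) tE /=.
    by rewrite odd_double rE.
rewrite addnS -addSn; have oddt : odd (tape c i) = false.
  by rewrite tE /= odd_double.
have tS : tape c i.+1 = str_code (load_emit w ++ s).
  change (code_drop2 (tape c i) = str_code (load_emit w ++ s)).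
  by rewrite tE code_drop2_cons.
have rS : register c i.+1 = (r + r + b).+1.
  rewrite /register /= -/(register c i) oddt rE; congr (_ + nat_of_bool _).+1.
  by rewrite tE /=; case: (b); lia.
have [-> -> ->] := IH _ _ tS rS; split=> //.
by congr (_ + _)%N; rewrite /output /= -/(output c i) oddt.
Qed.

Lemma load_surj d : exists w, load 0 w = d /\ (2 ^ size w <= d.+1)%N.
Proof.
elim/ltn_ind: d => -[_|d IH]; first by exists [::].
have [|w [wd ws]] := IH d./2; first by lia.
exists (rcons w (odd d)); rewrite /load foldl_rcons size_rcons expnS.
by rewrite -/(load 0 w) wd; split; lia.
Qed.

(** The suffix s and the step i are arbitrary so that programs can be
concatenated. The length is at most twice that of the numbers in binary, plus
two letters for each output instruction. *)
Lemma exec_program n (ds : seq nat) : all (fun d => (d <= n)%N) ds ->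
  exists p, (size p <= size ds * (trunc_log 2 n.+1).+1.*2)%N /\
    forall s c i, tape c i = str_code (p ++ s) -> register c i = 0%N ->
    exists j, [/\ (j <= i + size p)%N, tape c j = str_code s,
      register c j = 0%N & output c j = (output c i + \sum_(d <- ds) 2 ^ d)%N].
Proof.
elim: ds => [_|d ds IH /= /andP[dn /IH[p [ps pP]]]].
  exists [::]; split=> // s c i ti ri; exists i; rewrite addn0 big_nil addn0.
  by split.
have [w [wd ws]] := load_surj d.
exists (load_emit w ++ p); split.
  rewrite size_cat size_load_emit mulSn leq_add// leq_double ltnS.
  by apply: trunc_log_max => //; apply: leq_trans ws _.
move=> s c i; rewrite -catA => /exec_load_emit/[apply]; rewrite wd.
move=> -[tj rj oj]; have [k [ki tk rk ok]] := pP _ _ _ tj rj.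
exists k; split=> //; last by rewrite ok oj big_cons addnA.
apply: leq_trans ki _; rewrite size_cat size_load_emit; lia.
Qed.

Lemma output_halted c i j :
  tape c i = 0%N -> (i <= j)%N -> output c j = output c i.
Proof.
move=> ti /subnKC <-; elim: (j - i)%N => [|k IH]; first by rewrite addn0.
have tk : tape c (i + k) = 0%N.
  elim: k {IH} => [|k IH]; first by rewrite addn0.
  by rewrite addnS -[LHS]/(code_drop2 (tape c (i + k))) IH.
by rewrite addnS /output /= -/(output c (i + k)) tk IH.
Qed.

Lemma decode_positions_program n (ds : seq nat) :
  all (fun d => (d <= n)%N) ds ->
  exists p, (size p <= size ds * (trunc_log 2 n.+1).+1.*2)%N /\
    decode_positions (str_code p) = (\sum_(d <- ds) 2 ^ d).-1%N.
Proof.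
move=> /exec_program[p [ps pP]]; exists p; split=> //.
have [|//|j [jp tj _ oj]] := pP [::] (str_code p) 0%N; first by rewrite cats0.
rewrite /decode_positions (output_halted tj) ?oj//.
exact: leq_trans jp (size_le_str_code p).
Qed.

(** The exponents of the binary digits 1 of str_code s + 1, shifted by k. The
last one is the length of s, without which the trailing zeros would be lost. *)
Fixpoint ones_and_end (k : nat) (s : seq bool) : seq nat :=
  if s is b :: s' then nseq b k ++ ones_and_end k.+1 s' else [:: k].

Lemma size_ones_and_end k s : size (ones_and_end k s) = (count id s).+1.
Proof.
by elim: s k => [//|b s IH] k /=; rewrite size_cat size_nseq IH addnS.
Qed.

Lemma ones_and_end_le k s :
  all (fun d => (d <= k + size s)%N) (ones_and_end k s).
Proof.
elim: s k => [|b s IH] k /=; first by rewrite addn0 leqnn.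
by rewrite all_cat addnS -addSn IH andbT all_nseqb; case: (b) => //=; lia.
Qed.

Lemma sum_ones_and_end k s :
  (\sum_(d <- ones_and_end k s) 2 ^ d = 2 ^ k * (str_code s).+1)%N.
Proof.
elim: s k => [|b s IH] k /=; first by rewrite big_seq1 muln1.
rewrite big_cat /= IH expnS; case: b => /=; rewrite ?big_nil ?big_seq1; nia.
Qed.

(** * Complexity of binary words *)

Section Complexity.
Variables (C : seq bool -> option (seq bool)) (hC : universal C).

Lemma partial_recursive_computable (F : nat -> nat)
    (D : seq bool -> option (seq bool)) :
  computable (fun v : 1.-tuple nat => F (thead v)) ->
  (forall p, exists2 s, D p = Some s & str_code s = F (str_code p)) ->
  partial_recursive D.
Proof.
move=> [f fP] DF; exists f => p s; rewrite fP.
have [t Dt <-] := DF p; rewrite Dt.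
by split=> [[->] //|/str_code_inj ->].
Qed.

(** The default value in [AIC] is never used: through universality, the identity
provides a program for every word. *)
Lemma AIC_min s : (exists2 p, C p = Some s & size p = AIC C s) /\
  (forall p, C p = Some s -> (AIC C s <= size p)%N).
Proof.
have [|pI pIP] := hC.2 Some.
  apply: (partial_recursive_computable (F := id)).
    exact: computable_proj.
  by move=> p; exists p.
have ex : exists l, `[< exists2 p, C p = Some s & size p = l >].
  by exists (size (pI ++ s)); apply/asboolP; exists (pI ++ s).
pose X := [set l : nat | (exists2 p, C p = Some s & size p = l) /\
                          (forall p, C p = Some s -> (l <= size p)%N)].
suff : X (AIC C s) by [].
apply: (@xgetPex _ 0%N X); case: (ex_minnP ex) => l /asboolP lP lmin.
exists l; split=> // p Cp; apply: lmin; apply/asboolP; by exists p.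
Qed.

(** The program consists of a fixed prefix that simulates the machine, followed
by instructions for the positions of the ones of s and for its length. *)
Lemma AIC_le_count : exists c : nat, forall s,
  (AIC C s <= c + (count id s).+1 * (trunc_log 2 (size s).+1).+1.*2)%N.
Proof.
have [g gP] := choice str_code_surj.
pose D p := Some (g (decode_positions (str_code p))).
have [|pD pDP] := hC.2 D.
  apply: partial_recursive_computable computable_decode_positions _ => p.
  by eexists.
exists (size pD) => s.
have [p [ps pE]] := decode_positions_program (ones_and_end_le 0 s).
rewrite size_ones_and_end add0n in ps.
rewrite sum_ones_and_end expn0 mul1n /= in pE.
apply: leq_trans (_ : size (pD ++ p) <= _)%N.
  apply: (AIC_min s).2; rewrite -pDP /D pE; congr Some.
  by apply: str_code_inj.
by rewrite size_cat leq_add2l.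
Qed.

(** There are at most 2^l words of complexity l, because shortest programs of
distinct words are distinct; so the sum is at most that of (2 / 4)^l. *)
Lemma sum_AIC_le (R : realType) (r : R) n : 0 <= r -> r <= 4^-1 ->
  \sum_(s : n.-tuple bool) r ^+ AIC C s <= 2.
Proof.
move=> r0 r4.
pose M := (\max_(s : n.-tuple bool) AIC C s)%N.
have Mlt (s : n.-tuple bool) : (AIC C s < M.+1)%N.
  by rewrite ltnS; exact: leq_bigmax.
rewrite (partition_big (fun s : n.-tuple bool => Ordinal (Mlt s)) xpredT)//=.
have E (i : 'I_M.+1) :
    \sum_(s : n.-tuple bool | Ordinal (Mlt s) == i) r ^+ AIC C s <= 2^-1 ^+ i.
  have -> : \sum_(s : n.-tuple bool | Ordinal (Mlt s) == i) r ^+ AIC C s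
       = \sum_(s : n.-tuple bool | Ordinal (Mlt s) == i) r ^+ i.
    by apply: eq_bigr => s /eqP <-.
  rewrite sumr_const.
  have /choice[f fP] (s : n.-tuple bool) : exists p : i.-tuple bool,
      Ordinal (Mlt s) == i -> C p = Some (s : seq bool).
    have [/eqP <-|_] := boolP (Ordinal (Mlt s) == i); last first.
      by exists [tuple of nseq i true].
    have [[p Cp /eqP sp] _] := AIC_min s.
    by exists (Tuple sp).
  have le2 : (#|[pred s : n.-tuple bool | Ordinal (Mlt s) == i]| <= 2 ^ i)%N.
    have <- : #|{: i.-tuple bool}| = (2 ^ i)%N by rewrite card_tuple card_bool.
    apply: (@leq_card_in _ _ f) => s t /=; rewrite !inE => /fP Cs /fP Ct e.
    by apply: val_inj; rewrite e Ct in Cs; case: Cs => /esym.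
  rewrite -[leLHS]mulr_natr.
  apply: le_trans (_ : 4^-1 ^+ i * (2 ^ i)%:R <= _).
    by apply: ler_pM; rewrite ?exprn_ge0// ?lerXn2r ?nnegrE ?ler_nat// invr_ge0.
  by rewrite natrX -exprMn (_ : 4^-1 * 2%:R = 2^-1 :> R)//; field.
apply: le_trans (ler_sum _ (fun i _ => E i)) _.
have -> : forall k, \sum_(i < k) (2^-1 : R) ^+ i = 2 - 2 * 2^-1 ^+ k.
  elim=> [|k IH]; first by rewrite big_ord0 expr0; ring.
  by rewrite big_ord_recr /= IH exprS; field.
by rewrite gerBl mulr_ge0 ?exprn_ge0// invr_ge0.
Qed.

Lemma AIC_eq0 s t : AIC C s = 0%N -> AIC C t = 0%N -> s = t.
Proof.
have [[p Cp <-] _] := AIC_min s; have [[p' Cp' <-] _] := AIC_min t.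
by move=> /size0nil e /size0nil e'; move: Cp Cp'; rewrite e e' => -> [].
Qed.

End Complexity.

(** * Symbolic orbits of the piecewise linear map *)

Section PL.
Variables (R : realType) (eps : nat -> R) (heps : PL_sequence eps).

Implicit Types x y : R.

Let L := PL_map eps.
Let e := epsm1 eps.
Let d k := e k - eps k.

Lemma PL_eps_gt0 k : 0 < eps k. Proof. by case: heps. Qed.
Lemma PL_epsm1_gt k : eps k < e k.
Proof. by case: heps => _ h1 _ h2 _; case: k => [|k] //=. Qed.
Lemma PL_width_gt0 k : 0 < d k. Proof. by rewrite subr_gt0 PL_epsm1_gt. Qed.
Lemma PL_epsm1_le i j : (i <= j)%N -> e j <= e i.
Proof.
move=> /subnKC <-; elim: (j - i)%N => [|k IH]; first by rewrite addn0.
by rewrite addnS; apply: le_trans IH; rewrite ltW// [e _.+1]/= PL_epsm1_gt.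
Qed.
Lemma PL_eps_ltm1 i j : (i < j)%N -> e j <= eps i.
Proof. exact: (@PL_epsm1_le i.+1 j). Qed.

(** The affine parametrization of (eps_k, eps_(k-1)] by (0, 1]. In these
coordinates L sends (k.+1, y) to (k, y), and (0, y) to the point y: the time
before the visit to I_1 and the point reached after it are independent. *)
Definition branch k (y : R) : R := eps k + d k * y.

Lemma branch_bounds k y : 0 < y <= 1 -> eps k < branch k y <= e k.
Proof.
move=> /andP[y0 y1]; have dk := PL_width_gt0 k.
rewrite /branch ltrDl mulr_gt0//=.
have : d k * y <= d k * 1 by rewrite ler_pM2l.
by rewrite mulr1 /d; lra.
Qed.

Lemma branch_itv k y : 0 < y <= 1 -> 0 < branch k y <= 1.
Proof.
move=> /(branch_bounds k)/andP[lb ub]; rewrite (lt_trans (PL_eps_gt0 k) lb) /=.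
exact: le_trans ub (PL_epsm1_le (leq0n k)).
Qed.

Lemma branch_surj x : 0 < x <= 1 -> exists k y, 0 < y <= 1 /\ x = branch k y.
Proof.
move=> /andP[x0 x1].
have ex : exists k, eps k < x.
  have [_ _ /cvgrPdist_lt /(_ x x0) cv _ _] := heps.
  have [N _ /(_ N (leqnn N))] := cv.
  rewrite /= sub0r normrN gtr0_norm ?PL_eps_gt0// => ltx; by exists N.
have [k kx kmin] := ex_minnP ex.
have xe : x <= e k.
  case: k {kx} kmin => [_ //|k kmin]; rewrite leNgt; apply/negP => /kmin.
  by rewrite ltnn.
exists k, ((x - eps k) / d k); have dk := PL_width_gt0 k; split.
  apply/andP; split; first by rewrite divr_gt0// subr_gt0.
  by rewrite ler_pdivrMr// mul1r /d lerD2r.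
by rewrite /branch; field; rewrite gt_eqF.
Qed.

Lemma PL_map_branch0 y : 0 < y <= 1 -> L (branch 0 y) = y.
Proof.
move=> y01; have /andP[b0 _] := branch_itv 0 y01.
have /andP[lb _] := branch_bounds 0 y01; rewrite /L /PL_map gt_eqF// lb.
have := PL_width_gt0 0; rewrite /branch /d /e /= => h.
by field; rewrite gt_eqF.
Qed.

Lemma PL_map_branchS k y : 0 < y <= 1 -> L (branch k.+1 y) = branch k y.
Proof.
move=> y01; have /andP[b0 _] := branch_itv k.+1 y01.
have bb := branch_bounds k.+1 y01; have /andP[lb ub] := bb.
rewrite /L /PL_map gt_eqF// ltNge (le_trans ub (PL_eps_ltm1 (ltn0Sn k)))/=.
case: xgetP => [j _ [j1 /andP[lj uj]]|/(_ k.+1)]; last by case; split.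
have -> : j = k.+1.
  apply/eqP; rewrite eqn_leq; apply/andP; split.
    rewrite leqNgt; apply/negP => /PL_eps_ltm1 h.
    by have := le_lt_trans (le_trans uj h) lb; rewrite ltxx.
  rewrite leqNgt; apply/negP => /PL_eps_ltm1 h.
  by have := le_lt_trans (le_trans ub h) lj; rewrite ltxx.
have := PL_width_gt0 k.+1; rewrite /branch /d /e /= => h.
by field; rewrite gt_eqF.
Qed.

Lemma PL_cellE x : 0 < x <= 1 -> (x \in PL_cell eps true) = (eps 0%N < x).
Proof.
move=> /andP[x0 x1]; apply/idP/idP.
  by rewrite inE /= in_itv /= => /andP[].
by move=> h; rewrite inE /= in_itv /= h x1.
Qed.

Definition itinerary n x : seq bool := mkseq (PL_symbol eps x) n.

Lemma itineraryS n x :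
  itinerary n.+1 x = (x \in PL_cell eps true) :: itinerary n (L x).
Proof.
rewrite /itinerary /mkseq /= -[1%N]addn0 iotaDl -map_comp; congr cons.
by apply: eq_map => i; rewrite /= add1n /PL_symbol iterSr.
Qed.

Lemma itinerary_branch0 n y : 0 < y <= 1 ->
  itinerary n.+1 (branch 0 y) = true :: itinerary n y.
Proof.
move=> y01; rewrite itineraryS PL_map_branch0// PL_cellE ?branch_itv//.
by have /andP[->] := branch_bounds 0 y01.
Qed.

Lemma itinerary_branchS n k y : 0 < y <= 1 ->
  itinerary n.+1 (branch k.+1 y) = false :: itinerary n (branch k y).
Proof.
move=> y01; rewrite itineraryS PL_map_branchS// PL_cellE ?branch_itv//.
have /andP[_ ub] := branch_bounds k.+1 y01.
by rewrite ltNge (le_trans ub (PL_eps_ltm1 (ltn0Sn k))).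
Qed.

Lemma itinerary_branch_zeros n k y : 0 < y <= 1 ->
  (itinerary n (branch k y) == nseq n false) = (n <= k)%N.
Proof.
move=> y01; elim: n k => [//|n IH] [|k].
  by rewrite itinerary_branch0.
by rewrite itinerary_branchS//= eqseq_cons/= IH.
Qed.

Lemma itinerary_branch_eq n j k s y : 0 < y <= 1 -> size s = n ->
  (itinerary (k + n.+1) (branch j y) == nseq k false ++ true :: s) =
  (j == k) && (itinerary n y == s).
Proof.
move=> y01 sn; elim: k j => [|k IH] [|j].
- by rewrite itinerary_branch0// eqseq_cons.
- by rewrite itinerary_branchS// eqseq_cons.
- by rewrite addSn itinerary_branch0// eqseq_cons.
- by rewrite addSn itinerary_branchS// eqseq_cons/= IH eqSS.
Qed.

(** Induction along the renewals of a word: its successive blocks 0^k 1, the last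
one possibly incomplete. *)
Lemma bitseq_run_ind (P : seq bool -> Prop) :
  (forall n, P (nseq n false)) ->
  (forall k s, P s -> P (nseq k false ++ true :: s)) ->
  forall s, P s.
Proof.
move=> P0 P1 s; suff : forall k, P (nseq k false ++ s) by move=> /(_ 0%N).
elim: s => [k|[] s IH k]; first by rewrite cats0.
  by apply: P1; exact: IH 0%N.
by have := IH k.+1; rewrite -addn1 nseqD -catA.
Qed.

(** A bound on the measure of both cells of the partition, hence on the length of
every branch and on the probability of every nonempty word. *)
Definition max_cell_length : R := Num.max (eps 0%N) (1 - eps 0%N).
Let q := max_cell_length.

Lemma max_cell_length_gt0 : 0 < q.
Proof. by rewrite /q /max_cell_length lt_max PL_eps_gt0. Qed.
Lemma max_cell_length_lt1 : q < 1.
Proof.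
have := PL_eps_gt0 0; have := PL_width_gt0 0.
by rewrite /q /max_cell_length /d /e /= gt_max; lra.
Qed.

Lemma PL_width_le k : d k <= q.
Proof.
rewrite /q /max_cell_length le_max; case: k => [|k].
  by rewrite /d /= lexx orbT.
apply/orP; left; rewrite /d.
have := PL_eps_gt0 k.+1; have := @PL_epsm1_le 1 k.+1 isT; rewrite /e /=; lra.
Qed.

(** The cylinder of 0^k 1 s is the image of that of s under [branch k], and so an
interval shorter by a factor d k <= q; the cylinder of 0^n is (0, eps_(n-1)].
The point 0, which has measure zero, is left out. *)
Lemma cylinder_itv s : exists ab : R * R,
  [/\ 0 <= ab.1, ab.1 <= ab.2, ab.2 <= 1,
      ab.2 - ab.1 <= q ^+ count id s /\ (s != [::] -> ab.2 - ab.1 <= q)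
    & forall x, 0 < x <= 1 ->
        (itinerary (size s) x == s) = (ab.1 < x <= ab.2)].
Proof.
elim/bitseq_run_ind: s => [n|k s [[a b] /= [a0 ab b1 [abq _] abP]]].
  exists (0, e n); split => /=.
  - by [].
  - exact: ltW (lt_trans (PL_eps_gt0 n) (PL_epsm1_gt n)).
  - exact: (@PL_epsm1_le 0 n).
  - rewrite count_nseq /= mul0n expr0 subr0; split.
      exact: (@PL_epsm1_le 0 n).
    case: n => // n _; rewrite le_max; apply/orP; left.
    exact: (@PL_epsm1_le 1 n.+1).
  - move=> x /branch_surj[k [y [y01 ->]]].
    rewrite size_nseq itinerary_branch_zeros//.
    have /andP[-> _] /= := branch_itv k y01.
    have /andP[lb ub] := branch_bounds k y01.
    apply/idP/idP => [/PL_epsm1_le|]; first exact: le_trans.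
    move=> h; rewrite leqNgt; apply/negP => /PL_eps_ltm1 h'.
    by have := le_lt_trans (le_trans h h') lb; rewrite ltxx.
have dk := PL_width_gt0 k; have q0 := max_cell_length_gt0.
have ba : branch k b - branch k a = d k * (b - a) by rewrite /branch; ring.
have bm (u v : R) : u <= v -> branch k u <= branch k v.
  by move=> uv; rewrite /branch lerD2l ler_pM2l.
have bk0 : branch k 0 = eps k by rewrite /branch mulr0 addr0.
have bk1 : branch k 1 = e k by rewrite /branch /d mulr1 addrC subrK.
exists (branch k a, branch k b); split => /=.
- by apply: le_trans (bm _ _ a0); rewrite bk0 ltW// PL_eps_gt0.
- exact: bm.
- by apply: le_trans (bm _ _ b1) _; rewrite bk1 (@PL_epsm1_le 0 k).
- rewrite ba count_cat count_nseq mul0n add0n /= add1n exprS; split.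
    by apply: (ler_pM (ltW dk) _ (PL_width_le k) abq); rewrite subr_ge0.
  move=> _; apply: le_trans (PL_width_le k).
  by rewrite ger_pMr//; lra.
- move=> x /branch_surj[j [y [y01 ->]]].
  rewrite size_cat size_nseq /= itinerary_branch_eq//.
  have /andP[lb ub] := branch_bounds j y01.
  case: (ltngtP j k) => [jk|kj|->] /=.
  + have h : branch k b <= eps j.
      by apply: le_trans (bm _ _ b1) _; rewrite bk1; exact: PL_eps_ltm1.
    by rewrite [branch j y <= _]leNgt (le_lt_trans h lb) andbF.
  + have h : e j <= branch k a.
      by apply: le_trans (PL_eps_ltm1 kj) _; rewrite -bk0; exact: bm.
    by rewrite ltNge (le_trans ub h).
  + by rewrite abP// /branch ltrD2l lerD2l ltr_pM2l// ler_pM2l.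
Qed.
End PL.

Lemma visitsE (R : realType) (eps : nat -> R) n x :
  visits eps n x = count id (itinerary eps n x).
Proof.
rewrite /visits /itinerary /mkseq count_map.
rewrite -val_enum_ord count_map cardE -size_filter /enum_mem.
by rewrite -filter_predI; congr size; apply: eq_filter => i; rewrite /= andbT.
Qed.

(** * Law of the first n symbols *)

(** On (0, 1] a function of the first n symbols is a combination of indicators of
the cylinders, which are disjoint intervals covering (0, 1]; removing the point
0 from [0, 1] does not change the integral. *)
Lemma itinerary_law (R : realType) (eps : nat -> R) (heps : PL_sequence eps) n :
  let q := max_cell_length eps in
  exists p : n.-tuple bool -> R,
  [/\ forall s, 0 <= p s, forall s, p s <= q ^+ count id s,
      (0 < n)%N -> forall s, p s <= q
    & forall X : seq bool -> nat,
      expectation01 (fun x => X (itinerary eps n x)) =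
      (\sum_(s : n.-tuple bool) p s * (X s)%:R)%:E].
Proof.
move=> q.
have /choice[ab abP] (s : n.-tuple bool) := cylinder_itv heps s.
pose J (s : n.-tuple bool) : set R := [set` `](ab s).1, (ab s).2]].
have mJ s : measurable (J s) by exact: measurable_itv.
exists (fun s => (ab s).2 - (ab s).1); split.
- by move=> s; have [_ + _ _ _] := abP s; rewrite subr_ge0.
- by move=> s; have [_ _ _ [] ] := abP s.
- move=> n0 s; have [_ _ _ [_ + _]] := abP s; apply.
  by rewrite -size_eq0 size_tuple -lt0n.
move=> X; rewrite /expectation01.
pose f (s : n.-tuple bool) (x : R) := ((X s)%:R * \1_(J s) x)%:E : \bar R.
have mf (D : set R) s : measurable_fun D (f s).
  by apply/measurable_EFinP; apply: measurable_funM => //.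
have fE (x : R) : x \in [set` `](0%R : R), (1%R : R)]] ->
    (X (itinerary eps n x))%:R%:E = (\sum_(s : n.-tuple bool) f s x)%E.
  rewrite inE /= in_itv /= => x01.
  have indE (s : n.-tuple bool) : \1_(J s) x = (itinerary eps n x == s)%:R :> R.
    rewrite indicE /J mem_setE in_itv /=.
    by have [_ _ _ _ <-//] := abP s; rewrite size_tuple.
  have tP : size (itinerary eps n x) == n by rewrite size_mkseq.
  rewrite /f sumEFin (bigD1 (Tuple tP))//= indE eqxx mulr1 big1 ?addr0//.
  move=> s; rewrite indE => sx.
  rewrite (_ : _ == _ = false) ?mulr0//.
  by apply: contra_neqF sx => /eqP h; apply/val_inj.
have mE : measurable_fun ([set` `](0%R : R), (1%R : R)]] : set R)
    (fun x : R => (X (itinerary eps n x))%:R%:E : \bar R).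
  apply: (eq_measurable_fun (fun x => (\sum_(s : n.-tuple bool) f s x)%E)).
    by move=> x /fE ->.
  exact: emeasurable_sum.
rewrite -integral_itv_obnd_cbnd//.
transitivity (\int[lebesgue_measure]_(x in [set` `](0%R : R), (1%R : R)]])
    \sum_(s : n.-tuple bool) f s x)%E; first exact: eq_integral.
rewrite ge0_integral_sum//; last 2 first.
  by move=> s; exact: mf.
  by move=> s x _; rewrite lee_fin mulr_ge0// indicE.
rewrite -sumEFin; apply: eq_bigr => s _.
transitivity ((X s)%:R%:E *
    \int[lebesgue_measure]_(x in [set` `](0%R : R), (1%R : R)]])
      (\1_(J s) x)%:E)%E.
  have mI : measurable ([set` `](0%R : R), (1%R : R)]] : set R) by [].
  have X0 : (X s)%:R < 0 :> R -> J s = set0 by rewrite ltNge ler0n.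
  exact: (@integralZl_indic _ _ R lebesgue_measure _ mI (fun=> J s) _ X0 (mJ s)).
rewrite integral_indic//; last exact: mJ.
have [a0 le_ab b1 _ _] := abP s.
have -> : J s `&` [set` `](0%R : R), (1%R : R)]] = J s.
  apply/setIidl => x; rewrite /J /= !in_itv /= => /andP[ax xb].
  by rewrite (le_lt_trans a0 ax) (le_trans xb b1).
rewrite [X in (_ * X)%E](@lebesgue_measure_itv R `](ab s).1, (ab s).2])/=.
rewrite lte_fin.
case: ltgtP le_ab => // [_|->] _; first by rewrite -EFinB -EFinM mulrC.
by rewrite subrr mul0r mule0.
Qed.

Lemma sum_itinerary_law (R : realType) (eps : nat -> R) n
    (p : n.-tuple bool -> R) :
  (forall X : seq bool -> nat, expectation01 (fun x => X (itinerary eps n x)) =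
      (\sum_(s : n.-tuple bool) p s * (X s)%:R)%:E) ->
  \sum_s p s = 1.
Proof.
move=> /(_ (fun=> 1%N)); under eq_bigr do rewrite mulr1.
rewrite /expectation01 integral_cst// mul1e.
rewrite [LHS](@lebesgue_measure_itv R `[0, 1])/= lte_fin ltr01 oppr0 adde0.
by move=> [].
Qed.

(** * Means under a finite law *)

Section FiniteLaw.
Variables (R : realType) (T : finType) (p : T -> R) (q : R).
Hypotheses (p0 : forall s, 0 <= p s) (p1 : \sum_s p s = 1).
Hypotheses (q0 : 0 < q) (q1 : q < 1).

(** The zero set of X has at most one point, hence mass at most q, and X is at
least 1 elsewhere. *)
Lemma mean_ge_of_inj0 (X : T -> nat) :
  (forall s, p s <= q) -> (forall s t, X s = 0%N -> X t = 0%N -> s = t) ->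
  1 - q <= \sum_s p s * (X s)%:R.
Proof.
move=> pq Xinj.
have [/existsP[s0 /eqP Xs0]|/existsPn noz] := boolP [exists s, X s == 0%N].
  rewrite (bigD1 s0)//= Xs0 mulr0 add0r.
  apply: le_trans (_ : \sum_(s | s != s0) p s <= _).
    by have := p1; rewrite (bigD1 s0)//=; have := pq s0; lra.
  apply: ler_sum => s ss0; rewrite ler_peMr// ler1n lt0n.
  by apply: contra ss0 => /eqP Xs; apply/eqP/Xinj.
apply: le_trans (_ : \sum_s p s <= _); first by rewrite p1 gerBl ltW.
by apply: ler_sum => s _; rewrite ler_peMr// ler1n lt0n noz.
Qed.

(** The m equal terms q^m are bounded by 1, q, q^2, and so on, whose sum is
(1 - q^m) / (1 - q). *)
Lemma exp_decay_linear m : m%:R * (1 - q) * q ^+ m <= 1 - q ^+ m.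
Proof.
elim: m => [|m IH]; first by rewrite !mul0r expr0 subrr.
have qm1 : q ^+ m.+1 <= 1 by apply: exprn_ile1; rewrite ltW.
rewrite -natr1 exprS; rewrite exprS in qm1.
have h1 : 0 <= q * (1 - q ^+ m - m%:R * (1 - q) * q ^+ m).
  by rewrite mulr_ge0 ?(ltW q0)// subr_ge0.
have h2 : 0 <= (1 - q) * (1 - q * q ^+ m).
  by rewrite mulr_ge0 ?subr_ge0 ?(ltW q1).
lra.
Qed.

(** If a point s has N s > D (a s), its excess m = N s - D (a s) has weight
m p(s) <= q^(D (a s)) m q^m, and m q^m <= 1 / (1 - q). *)
Lemma mean_le_of_length (N a : T -> nat) (D : nat) (K : R) :
  (forall s, p s <= q ^+ N s) -> \sum_s (q ^+ D) ^+ a s <= K ->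
  \sum_s p s * (N s)%:R <= D%:R * (\sum_s p s * (a s)%:R) + K / (1 - q).
Proof.
move=> pN aK; have q'0 : 0 < 1 - q by rewrite subr_gt0.
have H s : p s * (N s)%:R - D%:R * (p s * (a s)%:R) <=
    (q ^+ D) ^+ a s / (1 - q).
  rewrite ler_pdivlMr// -exprM mulrCA -mulrBr -natrM.
  have [Na|Na] := leqP (N s) (D * a s).
    apply: le_trans (exprn_ge0 _ (ltW q0)); rewrite -mulrA mulr_ge0_le0//.
    by rewrite mulr_le0_ge0 ?(ltW q'0)// subr_le0 ler_nat.
  rewrite -natrB 1?ltnW//; set m := (N s - D * a s)%N.
  apply: le_trans (_ : q ^+ N s * m%:R * (1 - q) <= _).
    by rewrite -!mulrA ler_wpM2r// mulr_ge0// ltW.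
  rewrite -(subnKC (ltnW Na)) -/m exprD -!mulrA ler_piMr ?exprn_ge0 ?(ltW q0)//.
  have := exp_decay_linear m; have := exprn_ge0 m (ltW q0); lra.
rewrite -lerBlDl mulr_sumr -sumrB.
apply: le_trans (ler_sum _ (fun s _ => H s)) _.
by rewrite -mulr_suml ler_pM2r// invr_gt0.
Qed.
End FiniteLaw.

Lemma exprn_le_quarter (R : realType) (q : R) : 0 < q -> q < 1 ->
  exists D : nat, q ^+ D <= 4^-1.
Proof.
move=> q0 q1.
have /cvg_expr /cvgrPdist_lt /(_ (4^-1)) : `|q| < 1 by rewrite gtr0_norm.
rewrite invr_gt0 => /(_ (ltr0n _ 4)) [D _ /(_ D (leqnn D))] /=.
rewrite sub0r normrN ger0_norm ?exprn_ge0 ?(ltW q0)// => h.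
by exists D; apply: ltW.
Qed.

Lemma trunc_log_le_ln (R : realType) n : (2 <= n)%N ->
  (trunc_log 2 n.+1)%:R * ln 2 <= 2 * ln (n%:R : R).
Proof.
move=> n2; have n0 : 0 < n%:R :> R by rewrite ltr0n; lia.
rewrite !mulr_natl -!lnXn// ler_ln ?posrE ?exprn_gt0//.
rewrite -!natrX ler_nat; apply: leq_trans (trunc_logP _ _) _ => //.
by rewrite expnS expn1; nia.
Qed.

(** * Comparison of visits and complexity *)

Lemma visits_le_AIC (R : realType) (C : seq bool -> option (seq bool))
    (hC : universal C) (eps : nat -> R) (heps : PL_sequence eps) :
  preceq (fun n => expectation01 (visits eps n))
         (fun n => expectation01 (AIC_orbit C eps n)).
Proof.
have q0 := max_cell_length_gt0 heps; have q1 := max_cell_length_lt1 heps.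
have [D qD] := exprn_le_quarter q0 q1; set q := max_cell_length eps in q0 q1 qD.
exists (D%:R + 2 / (1 - q) / (1 - q)); near=> n.
have n0 : (0 < n)%N by near: n; exact: nbhs_infty_gt.
have [p [p_ge0 p_le p_leq pE]] := itinerary_law heps n.
have p1 := sum_itinerary_law pE.
rewrite (funext (visitsE eps n)) (pE (count id)) (pE (AIC C)).
rewrite !gee0_abs ?lee_fin ?sumr_ge0// => [|s _|s _]; try by rewrite mulr_ge0.
have EA : 1 - q <= \sum_(s : n.-tuple bool) p s * (AIC C s)%:R.
  apply: mean_ge_of_inj0 => // [|s t s0 t0]; first exact: p_leq.
  by apply: val_inj; exact: (AIC_eq0 hC s0 t0).
have EN := mean_le_of_length p_ge0 q0 q1 p_le
  (sum_AIC_le hC n (exprn_ge0 D (ltW q0)) qD).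
apply: le_trans EN _.
rewrite [leRHS]mulrDl lerD2l -[leRHS]mulrA ler_peMr//.
  by rewrite divr_ge0// subr_ge0 ltW.
by rewrite mulrC ler_pdivlMr ?subr_gt0// mul1r.
Unshelve. all: by end_near.
Qed.

Lemma AIC_le_visits_ln (R : realType) (C : seq bool -> option (seq bool))
    (hC : universal C) (eps : nat -> R) (heps : PL_sequence eps) :
  preceq (fun n => expectation01 (AIC_orbit C eps n))
         (fun n => (expectation01 (visits eps n) * (ln n%:R)%:E)%E).
Proof.
have q0 := max_cell_length_gt0 heps; have q1 := max_cell_length_lt1 heps.
set q := max_cell_length eps in q0 q1.
have [c cP] := AIC_le_count hC.
have l2 : 0 < ln (2 : R) by rewrite ln_gt0// ltr1n.
(* The length of each binary expansion, plus one, is at most 3 ln n / ln 2, and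
   its bits cost two letters each; c is absorbed since ln n >= ln 2. *)
set K := (c + 6)%:R / ln (2 : R).
exists (K * (1 + 1 / (1 - q))); near=> n.
have n2 : (1 < n)%N by near: n; exact: nbhs_infty_gt.
have [p [p_ge0 p_le p_leq pE]] := itinerary_law heps n.
have p1 := sum_itinerary_law pE.
rewrite (funext (visitsE eps n)) (pE (count id)) (pE (AIC C)).
have lnn : 0 < ln (n%:R : R) by rewrite ln_gt0// ltr1n.
set N := \sum_s p s * (count id s)%:R.
have N_ge0 : 0 <= N by apply: sumr_ge0 => s _; rewrite mulr_ge0.
rewrite -EFinM !gee0_abs ?lee_fin ?mulr_ge0 ?sumr_ge0 ?(ltW lnn)// => [|s _];
  last by rewrite mulr_ge0.
have EN : 1 - q <= N.
  apply: mean_ge_of_inj0 => // [|s t s0 t0]; first exact: p_leq (ltnW n2).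
  have z (u : n.-tuple bool) :
      count id u = 0%N -> (u : seq bool) = nseq n false.
    move=> /eqP; rewrite -leqn0 leqNgt -has_count => /hasPn uP.
    have /all_pred1P : all (pred1 false) u by apply/allP => -[] // /uP.
    by rewrite size_tuple.
  by apply: val_inj; rewrite /= (z s s0) (z t t0).
have H (s : n.-tuple bool) : p s * (AIC C s)%:R <=
    K * ln n%:R * (p s * (count id s)%:R + p s).
  rewrite -[X in _ + X]mulr1 -mulrDr mulrCA ler_wpM2l//.
  have := cP s; rewrite size_tuple; set t := trunc_log 2 n.+1.
  set k := count id s => leA.
  have ln2n : ln 2 <= ln n%:R :> R.
    by rewrite ler_ln ?posrE ?ltr0n ?ler_nat// ltnW.
  have tn := trunc_log_le_ln R n2; rewrite -/t in tn.
  apply: le_trans (_ : (c + 6)%:R * k.+1%:R * (ln n%:R / ln 2) <= _);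
    last first.
    rewrite -(natr1 k) /K le_eqVlt; apply/orP; left; apply/eqP.
    by field; rewrite gt_eqF.
  rewrite mulrA ler_pdivlMr//.
  have : (AIC C s)%:R <= c%:R + k.+1%:R * 2 * (t%:R + 1) :> R.
    rewrite natr1 -!natrM -natrD ler_nat (leq_trans leA)// -muln2 -mulnA.
    by rewrite [(t.+1 * 2)%N]mulnC mulnA.
  have k1 : 1 <= k.+1%:R :> R by rewrite ler1n.
  move: leA => _; set a := (AIC C s)%:R; set kk := k.+1%:R in k1 *.
  set tt := t%:R in tn *.
  move=> lea.
  apply: le_trans (_ : (c%:R + kk * 2 * (tt + 1)) * ln 2 <= _).
    by rewrite ler_pM2r.
  have h1 : 0 <= c%:R * (kk - 1) * ln 2 by rewrite !mulr_ge0 ?subr_ge0// ltW.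
  have h2 : 0 <= c%:R * kk * (ln n%:R - ln 2).
    by rewrite !mulr_ge0 ?subr_ge0//; lra.
  have h3 : 0 <= kk * (2 * ln n%:R - tt * ln 2).
    by rewrite mulr_ge0 ?subr_ge0//; lra.
  have h4 : 0 <= kk * (ln n%:R - ln 2) by rewrite mulr_ge0 ?subr_ge0//; lra.
  rewrite natrD; lra.
apply: le_trans (ler_sum _ (fun s _ => H s)) _.
rewrite -mulr_sumr big_split/= p1 -/N.
rewrite ger0_norm ?mulr_ge0 ?(ltW lnn)//.
rewrite [leRHS](_ : _ = K * ln n%:R * (N + N / (1 - q))); last by field; lra.
have K0 : 0 <= K by rewrite divr_ge0// ltW.
apply: ler_wpM2l; first by rewrite mulr_ge0// ltW.
by rewrite lerD2l ler_pdivlMr ?subr_gt0// mul1r.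
Unshelve. all: by end_near.
Qed.

Theorem theorem4p4 (R : realType)
    (C : seq bool -> option (seq bool)) (hC : universal C)
    (eps : nat -> R) (heps : PL_sequence eps)
    (A alpha : R) (hA : 0 < A) (halpha : 0 < alpha) (halpha1 : alpha != 1)
    (hF : (1 - PL_F eps x) / (A * x `^ (- alpha)) @[x --> +oo] --> (1 : R)) :
  preceq (fun n => expectation01 (visits eps n))
         (fun n => expectation01 (AIC_orbit C eps n)) /\
  preceq (fun n => expectation01 (AIC_orbit C eps n))
         (fun n => (expectation01 (visits eps n) * (ln n%:R)%:E)%E).
Proof. by split; [exact: visits_le_AIC|exact: AIC_le_visits_ln]. Qed.
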